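(* Let $F(\mathbf{X},\mathbf{Y})$ be a Boolean formula with outputs $\mathbf{X}=(x_1,\ldots,x_n)$ and inputs $\mathbf{Y}=(y_1,\ldots,y_m)$, and suppose $F$ is in $\mathsf{SynNNF}$ with respect to the sequence $\mathbf{X}$. Then: (i) for every $i\in\{1,\ldots,n\}$, $$\exists \mathbf{X}_1^i\, F(\mathbf{X},\mathbf{Y}) \;\Leftrightarrow\; \widehat{F}^{\,i+1}[\overline{\mathbf{X}}_{i+1}^n \mapsto \neg\mathbf{X}_{i+1}^n];$$ (ii) a Skolem function vector $\Psi_1^n=(\psi_1(\mathbf{Y}),\ldots,\psi_n(\mathbf{Y}))$ for $\mathbf{X}_1^n$ in $F$ can be computed in $\mathcal{O}(n^2\cdot |F|)$ time and $\mathcal{O}(n\cdot |F|)$ space.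
   Context: A formula is in negation normal form (NNF) if it uses only $\wedge,\vee,\neg$ and negation is applied only to variables. $|F|$ denotes the number of nodes of the (simplified) DAG representation of the NNF formula $F$. For $1\le i\le j\le n$, $\mathbf{X}_i^j=(x_i,\ldots,x_j)$. The positive form $\widehat{F}(\mathbf{X},\overline{\mathbf{X}},\mathbf{Y})$ of an NNF formula $F$ is obtained by replacing every occurrence of $\neg x_i$ ($x_i\in\mathbf{X}$) by a fresh variable $\overline{x}_i$. For $b,c\in\{0,1\}$, $\widehat{F}(\mathbf{b}^i,\mathbf{X}_{i+1}^n,\mathbf{c}^i,\overline{\mathbf{X}}_{i+1}^n,\mathbf{Y})$ denotes $\widehat{F}$ with $x_1,\ldots,x_i$ set to $b$ and $\overline{x}_1,\ldots,\overline{x}_i$ set to $c$. The $i$-th reduct is $\widehat{F}^{\,i}=\widehat{F}(1^{i-1},\mathbf{X}_i^n,1^{i-1},\overline{\mathbf{X}}_i^n,\mathbf{Y})$ for $i\in\{1,\ldots,n\}$, and $\widehat{F}^{\,n+1}=\widehat{F}(1^n,1^n,\mathbf{Y})$. For $j,k\in\{0,1\}$ let $\alpha_i^{jk}=\widehat{F}^{\,i}[x_i\mapsto j,\overline{x}_i\mapsto k,\overline{\mathbf{X}}_{i+1}^n\mapsto\neg\mathbf{X}_{i+1}^n]$; $\widehat{F}^{\,i}$ is $\wedge_i$-unrealizable if $\alpha_i^{11}\wedge\neg\alpha_i^{10}\wedge\neg\alpha_i^{01}$ is unsatisfiable. $F$ is in $\mathsf{SynNNF}$ w.r.t. $\mathbf{X}$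 if $F$ is in NNF and $\widehat{F}^{\,i}$ is $\wedge_i$-unrealizable for all $1\le i\le n$. A Skolem function vector for $\mathbf{X}$ in $F$ is a tuple of Boolean functions $\Psi=(\psi_1(\mathbf{Y}),\ldots,\psi_n(\mathbf{Y}))$ such that $\forall\mathbf{Y}\,(\exists\mathbf{X}\,F(\mathbf{X},\mathbf{Y})\Leftrightarrow F(\Psi(\mathbf{Y}),\mathbf{Y}))$ holds. *)

(* Defs.v *)
From mathcomp Require Import all_boot.

Set Implicit Arguments.
Unset Strict Implicit.
Unset Printing Implicit Defensive.

(** * Boolean formulas *)

Inductive form (V : Type) : Type :=
  | FConst of bool
  | FVar of V
  | FNot of form V
  | FAnd of form V & form V
  | FOr of form V & form V.

Arguments FConst {V} b.

Fixpoint eval (V : Type) (rho : V -> bool) (f : form V) : bool :=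
  match f with
  | FConst b => b
  | FVar v => rho v
  | FNot g => ~~ eval rho g
  | FAnd g h => eval rho g && eval rho h
  | FOr g h => eval rho g || eval rho h
  end.

Fixpoint subst (V W : Type) (s : V -> form W) (f : form V) : form W :=
  match f with
  | FConst b => FConst b
  | FVar v => s v
  | FNot g => FNot (subst s g)
  | FAnd g h => FAnd (subst s g) (subst s h)
  | FOr g h => FOr (subst s g) (subst s h)
  end.

Definition unsat (V : Type) (f : form V) : Prop :=
  forall rho : V -> bool, eval rho f = false.

Fixpoint is_nnf (V : Type) (f : form V) : bool :=
  match f with
  | FConst _ => true
  | FVar _ => true
  | FNot (FVar _) => true
  | FNot _ => false
  | FAnd g h => is_nnf g && is_nnf h
  | FOr g h => is_nnf g && is_nnf h
  end.

(** * Positive forms, reducts and SynNNF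

    Ordinals are 0-based: [X k] is the variable x_(k+1) of the mathematical
    text.  Natural-number indices [i] (of reducts etc.) are 1-based. *)

Inductive fvar (n m : nat) : Type := X of 'I_n | Y of 'I_m.
Arguments X {n m} k.
Arguments Y {n m} j.

Inductive pvar (n m : nat) : Type := PX of 'I_n | PXbar of 'I_n | PY of 'I_m.
Arguments PX {n m} k.
Arguments PXbar {n m} k.
Arguments PY {n m} j.

Definition asg (n m : nat) (x : 'I_n -> bool) (y : 'I_m -> bool)
    (v : fvar n m) : bool :=
  match v with X k => x k | Y j => y j end.

Definition pos_var (n m : nat) (v : fvar n m) : pvar n m :=
  match v with X k => PX k | Y j => PY j end.

(* Meaningful on formulas in NNF. *)
Fixpoint hat (n m : nat) (f : form (fvar n m)) : form (pvar n m) :=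
  match f with
  | FConst b => FConst b
  | FVar v => FVar (pos_var v)
  | FNot (FVar (X k)) => FVar (PXbar k)
  | FNot g => FNot (hat g)
  | FAnd g h => FAnd (hat g) (hat h)
  | FOr g h => FOr (hat g) (hat h)
  end.

(* The substitution x_1, ..., x_i := b and xbar_1, ..., xbar_i := c. *)
Definition set_prefix (n m : nat) (b c : bool) (i : nat) (v : pvar n m) :
    form (pvar n m) :=
  match v with
  | PX k => if k < i then FConst b else FVar v
  | PXbar k => if k < i then FConst c else FVar v
  | PY _ => FVar v
  end.

Definition reduct (n m : nat) (F : form (fvar n m)) (i : nat) :
    form (pvar n m) :=
  subst (set_prefix true true i.-1) (hat F).

(* The substitution x_i := b, xbar_i := c. *)
Definition set_one (n m : nat) (i : nat) (b c : bool) (v : pvar n m) :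
    form (pvar n m) :=
  match v with
  | PX k => if k.+1 == i then FConst b else FVar v
  | PXbar k => if k.+1 == i then FConst c else FVar v
  | PY _ => FVar v
  end.

(* xbar_k := ~ x_k.  Where it is applied below, the xbar_k that still occur
   are exactly those with k > i, so no index bound is needed. *)
Definition bar_neg (n m : nat) (v : pvar n m) : form (fvar n m) :=
  match v with
  | PX k => FVar (X k)
  | PXbar k => FNot (FVar (X k))
  | PY j => FVar (Y j)
  end.

Definition alpha (n m : nat) (F : form (fvar n m)) (i : nat) (b c : bool) :
    form (fvar n m) :=
  subst (@bar_neg n m) (subst (set_one i b c) (reduct F i)).

Definition and_unrealizable (n m : nat) (F : form (fvar n m)) (i : nat) : Prop :=
  unsat (FAnd (FAnd (alpha F i true true) (FNot (alpha F i true false)))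
              (FNot (alpha F i false true))).

Definition SynNNF (n m : nat) (F : form (fvar n m)) : Prop :=
  is_nnf F /\ forall i, 1 <= i <= n -> and_unrealizable F i.

(* Truth of "exists x_1 ... x_i, F" at the point (x, y); it does not depend on
   the first i components of x. *)
Definition ex_prefix (n m : nat) (F : form (fvar n m)) (i : nat)
    (x : 'I_n -> bool) (y : 'I_m -> bool) : Prop :=
  exists x' : 'I_n -> bool,
    (forall k : 'I_n, i <= k -> x' k = x k) /\ eval (asg x' y) F.

Definition is_skolem (n m : nat) (F : form (fvar n m))
    (psi : 'I_n -> ('I_m -> bool) -> bool) : Prop :=
  forall y : 'I_m -> bool,
    (exists x : 'I_n -> bool, eval (asg x y) F) <->
    eval (asg (fun k => psi k y) y) F.

(** * DAG representations

    A DAG is the list of its nodes in topological order; the arguments of a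
    node are positions of earlier nodes. *)

Inductive gate (V : Type) : Type :=
  | GConst of bool
  | GVar of V
  | GNot of nat
  | GAnd of nat & nat
  | GOr of nat & nat.

Arguments GConst {V} b.
Arguments GNot {V} p.
Arguments GAnd {V} p q.
Arguments GOr {V} p q.

Definition children (V : Type) (g : gate V) : seq nat :=
  match g with
  | GConst _ | GVar _ => [::]
  | GNot p => [:: p]
  | GAnd p q | GOr p q => [:: p; q]
  end.

Definition wf_dag (V : Type) (D : seq (gate V)) : Prop :=
  forall k g, onth D k = Some g -> all (fun p => p < k) (children g).

Definition gate_form (V : Type) (fs : seq (form V)) (g : gate V) : form V :=
  let arg p := nth (FConst false) fs p in
  match g with
  | GConst b => FConst b
  | GVar v => FVar v
  | GNot p => FNot (arg p)
  | GAnd p q => FAnd (arg p) (arg q)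
  | GOr p q => FOr (arg p) (arg q)
  end.

(* The k-th entry is the formula rooted at the k-th node. *)
Definition unfold_dag (V : Type) (D : seq (gate V)) : seq (form V) :=
  foldl (fun fs g => rcons fs (gate_form fs g)) [::] D.

(* The root is the last node. *)
Definition dag_of (V : Type) (F : form V) (D : seq (gate V)) : Prop :=
  wf_dag D /\ onth (unfold_dag D) (size D).-1 = Some F.

(** * Word RAM

    Unit-cost RAM with registers and a memory of finitely many cells.
    A program mentions only finitely many registers, so the space is the number
    of memory cells (input and output included).  All words are smaller than
    [W]; an overflow, an access outside the memory and a jump outside the
    program are faults ([None]). *)

Inductive instr : Type :=
  | IConst (r v : nat)       (* r := v *)
  | IMove (r a : nat)        (* r := a *)
  | IAdd (r a b : nat)       (* r := a + b *)
  | ISub (r a b : nat)       (* r := a - b, truncated at 0 *)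
  | ILoad (r a : nat)        (* r := mem[a] *)
  | IStore (a b : nat)       (* mem[a] := b *)
  | IJump (l : nat)
  | IJumpZ (a l : nat)       (* jump to l if a = 0 *)
  | IHalt.

Record config : Type := Config { pc : nat; regs : nat -> nat; mem : seq nat }.

Definition set_reg (W : nat) (c : config) (r v : nat) : option config :=
  if v < W then
    Some (Config (pc c).+1 (fun k => if k == r then v else regs c k) (mem c))
  else None.

Definition step (P : seq instr) (W : nat) (c : config) : option config :=
  match onth P (pc c) with
  | None | Some IHalt => None
  | Some (IConst r v) => set_reg W c r v
  | Some (IMove r a) => set_reg W c r (regs c a)
  | Some (IAdd r a b) => set_reg W c r (regs c a + regs c b)
  | Some (ISub r a b) => set_reg W c r (regs c a - regs c b)
  | Some (ILoad r a) => obind (set_reg W c r) (onth (mem c) (regs c a))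
  | Some (IStore a b) =>
      if regs c a < size (mem c) then
        Some (Config (pc c).+1 (regs c) (set_nth 0 (mem c) (regs c a) (regs c b)))
      else None
  | Some (IJump l) => Some (Config l (regs c) (mem c))
  | Some (IJumpZ a l) =>
      Some (Config (if regs c a == 0 then l else (pc c).+1) (regs c) (mem c))
  end.

Fixpoint run (P : seq instr) (W k : nat) (c : config) : option config :=
  if k is k'.+1 then obind (run P W k') (step P W c) else Some c.

Definition init_config (inp : seq nat) (s : nat) : config :=
  Config 0 (fun=> 0) (inp ++ nseq (s - size inp) 0).

(* On input [inp], with words smaller than [W], [P] halts after at most [t]
   steps in [s] memory cells, in a configuration satisfying [post]. *)
Definition computes (P : seq instr) (W t s : nat) (inp : seq nat)
    (post : config -> Prop) : Prop :=
  [/\ size inp <= s, all (fun w => w < W) inp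
    & exists k c, [/\ k <= t, run P W k (init_config inp s) = Some c,
                      onth P (pc c) = Some IHalt & post c]].

(** * Input and output formats *)

(* Every node takes three words; [ev] encodes a variable by two words. *)
Definition enc_gate (V : Type) (ev : V -> seq nat) (g : gate V) : seq nat :=
  match g with
  | GConst b => [:: 0; nat_of_bool b; 0]
  | GVar v => 1 :: ev v
  | GNot p => [:: 2; p; 0]
  | GAnd p q => [:: 3; p; q]
  | GOr p q => [:: 4; p; q]
  end.

Definition enc_dag (V : Type) (ev : V -> seq nat) (D : seq (gate V)) : seq nat :=
  flatten (map (enc_gate ev) D).

Definition enc_input_var (m : nat) (j : 'I_m) : seq nat := [:: 1; nat_of_ord j].

Definition enc_fvar (n m : nat) (v : fvar n m) : seq nat :=
  match v with X k => [:: 0; nat_of_ord k] | Y j => enc_input_var j end.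

Definition enc_problem (n m : nat) (D : seq (gate (fvar n m))) : seq nat :=
  [:: n; m; size D] ++ enc_dag (@enc_fvar n m) D.

Definition slice (b l : nat) (s : seq nat) : seq nat := take l (drop b s).

(* The memory holds a DAG [C] over the inputs, stored at address [regs 0] with
   [regs 1] nodes, and, at address [regs 2], the positions [outs] of the [n]
   output nodes. *)
Definition outputs_dag (n m : nat) (c : config) (C : seq (gate 'I_m))
    (outs : seq nat) : Prop :=
  [/\ size C = regs c 1,
      slice (regs c 0) (3 * size C) (mem c) = enc_dag (@enc_input_var m) C,
      size outs = n
    & slice (regs c 2) n (mem c) = outs].

(* The function of the inputs computed at output k. *)
Definition dag_fun (n m : nat) (C : seq (gate 'I_m)) (outs : seq nat)
    (k : 'I_n) (y : 'I_m -> bool) : bool :=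
  eval y (nth (FConst false) (unfold_dag C) (nth 0 outs k)).

Definition outputs_skolem (n m : nat) (F : form (fvar n m)) (c : config) : Prop :=
  exists (C : seq (gate 'I_m)) (outs : seq nat),
    [/\ outputs_dag n c C outs, wf_dag C,
        all (fun p => p < size C) outs
      & is_skolem F (dag_fun C outs)].

(* Main.v *)
Require Import Defs.
From mathcomp Require Import all_boot zify.

Set Implicit Arguments.
Unset Strict Implicit.
Unset Printing Implicit Defensive.

(* The positive form of an NNF formula is monotone in the x_k and xbar_k, so
   exists x_i, F^i implies F^(i+1) (all with xbar_k := ~ x_k for the later k);
   and_i-unrealizability is exactly the converse: if alpha_i^11 holds then so
   does alpha_i^10 (take x_i = 1) or alpha_i^01 (take x_i = 0).  Iterating
   gives (i), and shows that psi_i := alpha_i^10, with psi_(i+1), ..., psi_n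
   substituted for the later variables, is a Skolem function vector.

   For (ii), for each i = n, ..., 1 a copy of the DAG of F is emitted in which
   every node f becomes two gates, for the positive forms of f and of ~ f, so
   that a negation only has to refer to the second gate of its argument.  A
   table holds the pairs that currently stand for (x_k, xbar_k): (1, 0) for
   k = i, the pairs computed by the earlier copies for k > i, and (1, 1) for
   k < i.  The root of the copy then computes alpha_i^10 = psi_i.  Each gate is
   written in constant time, and there are O(n |F|) of them. *)

(** * Existential quantification in SynNNF *)

Section Reducts.

Variables n m : nat.
Implicit Types (F : form (fvar n m)) (a b x : 'I_n -> bool) (y : 'I_m -> bool).

Definition pasg a b y (v : pvar n m) : bool :=
  match v with PX k => a k | PXbar k => b k | PY j => y j end.

Definition hat_val F a b y : bool := eval (pasg a b y) (hat F).

Definition reduct_val F (i : nat) x y : bool :=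
  hat_val F (fun k => (k < i) || x k) (fun k => (k < i) || ~~ x k) y.

Lemma eq_eval (V : Type) (rho rho' : V -> bool) (f : form V) :
  rho =1 rho' -> eval rho f = eval rho' f.
Proof. by move=> e; elim: f => //= [g -> | g -> h -> | g -> h ->]. Qed.

Lemma eval_subst (V W : Type) (rho : W -> bool) (s : V -> form W) (f : form V) :
  eval rho (subst s f) = eval (fun v => eval rho (s v)) f.
Proof. by elim: f => //= [g -> | g -> h -> | g -> h ->]. Qed.

Lemma eq_hat_val F a a' b b' y :
  a =1 a' -> b =1 b' -> hat_val F a b y = hat_val F a' b' y.
Proof. by move=> ea eb; apply: eq_eval => -[k|k|j] /=. Qed.

Lemma hat_val_negb F x y : hat_val F x (negb \o x) y = eval (asg x y) F.
Proof.
rewrite /hat_val; elim: F => [b|[k|j]|g IH|g IHg h IHh|g IHg h IHh] //=;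
  rewrite ?IHg ?IHh //.
by case: g IH => [b|[k|j]|g|g h|g h] //= ->.
Qed.

Lemma hat_val_mono F a a' b b' y :
  is_nnf F -> (forall k, a k -> a' k) -> (forall k, b k -> b' k) ->
  hat_val F a b y -> hat_val F a' b' y.
Proof.
rewrite /hat_val => nnfF le_a le_b.
elim: F nnfF => [c|[k|j]|g _|g IHg h IHh|g IHg h IHh] //=.
- by move=> _; apply: le_a.
- by case: g => // -[k|j] _ //=; apply: le_b.
- by case/andP=> nnf_g nnf_h /andP[/(IHg nnf_g)-> /(IHh nnf_h)->].
- by case/andP=> nnf_g nnf_h /orP[/(IHg nnf_g)-> | /(IHh nnf_h)->]; rewrite ?orbT.
Qed.

Lemma eval_reduct F i x y :
  eval (asg x y) (subst (@bar_neg n m) (reduct F i.+1)) = reduct_val F i x y.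
Proof. by rewrite !eval_subst; apply: eq_eval => -[k|k|j] //=; case: ifP. Qed.

Lemma eval_alpha_compl F (i : 'I_n) c x y :
  eval (asg x y) (alpha F i.+1 c (~~ c)) = reduct_val F i [eta x with i |-> c] y.
Proof.
rewrite !eval_subst; apply: eq_eval => -[k|k|j] //=;
  by case: ltnP => //= _; rewrite eqSS val_eqE; case: (k == i).
Qed.

Lemma eval_alpha_true F (i : 'I_n) x y :
  eval (asg x y) (alpha F i.+1 true true) = reduct_val F i.+1 x y.
Proof.
rewrite !eval_subst; apply: eq_eval => -[k|k|j] //=;
  by rewrite ltnS; case: ltngtP => //= [lt_ik|->]; rewrite ?eqxx // eqSS gtn_eqF.
Qed.

(* alpha_i^10 is the i-th reduct at x_i = 1. *)
Lemma reduct_val_witness F (i : 'I_n) x y :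
  SynNNF F -> reduct_val F i.+1 x y ->
  reduct_val F i [eta x with i |-> reduct_val F i [eta x with i |-> true] y] y.
Proof.
case=> _ /(_ i.+1 (ltn_ord i) (asg x y)) /=.
rewrite eval_alpha_true -[false in alpha _ _ true false]/(~~ true).
rewrite -[true in alpha _ _ false true]/(~~ false) !eval_alpha_compl => unreal Fx.
by move: unreal; rewrite Fx /=; case e: (reduct_val F i _ y) => //= /negbFE.
Qed.

Lemma ex_prefix_reduct_val F i x y :
  is_nnf F -> ex_prefix F i x y -> reduct_val F i x y.
Proof.
move=> nnfF [x' [eq_x']]; rewrite -hat_val_negb.
by apply: hat_val_mono => // k /=; case: ltnP => //= /eq_x' ->.
Qed.

Lemma reduct_val_ex_prefix F i x y :
  SynNNF F -> i <= n -> reduct_val F i x y -> ex_prefix F i x y.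
Proof.
move=> synF; elim: i x => [|i IHi] x lt_in Fx.
  by exists x; split=> //; rewrite -hat_val_negb.
have Fx1 := reduct_val_witness (i := Ordinal lt_in) synF Fx.
have [x' [eq_x' Fx']] := IHi _ (ltnW lt_in) Fx1.
exists x'; split=> // k lt_ik; rewrite eq_x' 1?ltnW //=.
by rewrite -val_eqE /= gtn_eqF.
Qed.

Lemma ex_prefixE F i x y :
  SynNNF F -> i <= n ->
  ex_prefix F i x y <->
  eval (asg x y) (subst (@bar_neg n m) (reduct F i.+1)).
Proof.
move=> synF le_in; rewrite eval_reduct; split; last exact: reduct_val_ex_prefix.
by apply: ex_prefix_reduct_val; case: synF.
Qed.

End Reducts.

(** * Values of DAG nodes *)

Section NodeValues.

Variable V : Type.
Implicit Types (y : V -> bool) (C D : seq (gate V)) (g : gate V).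

Definition node_val y C (p : nat) : bool :=
  eval y (nth (FConst false) (unfold_dag C) p).

Definition pair_val y C (p : nat) : bool * bool := (node_val y C p, node_val y C p.+1).

Lemma unfold_dag_rcons C g :
  unfold_dag (rcons C g) = rcons (unfold_dag C) (gate_form (unfold_dag C) g).
Proof. exact: foldl_rcons. Qed.

Lemma size_unfold_dag C : size (unfold_dag C) = size C.
Proof. by elim/last_ind: C => // C g; rewrite unfold_dag_rcons !size_rcons => ->. Qed.

Lemma node_val_cat y C C' p : p < size C -> node_val y (C ++ C') p = node_val y C p.
Proof.
rewrite /node_val => lt_p; elim/last_ind: C' => [|C' g IH]; first by rewrite cats0.
by rewrite -rcons_cat unfold_dag_rcons nth_rcons size_unfold_dag size_cat ltn_addr.
Qed.

Lemma node_val_rcons y C g :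
  node_val y (rcons C g) (size C) = eval y (gate_form (unfold_dag C) g).
Proof. by rewrite /node_val unfold_dag_rcons nth_rcons size_unfold_dag ltnn eqxx. Qed.

Lemma pair_val_cat y C C' p :
  p.+1 < size C -> pair_val y (C ++ C') p = pair_val y C p.
Proof. by move=> lt_p; rewrite /pair_val !node_val_cat // ltnW. Qed.

Lemma pair_val_cat2 y C g g' :
  pair_val y (C ++ [:: g; g']) (size C) =
  (eval y (gate_form (unfold_dag C) g), eval y (gate_form (unfold_dag (rcons C g)) g')).
Proof.
rewrite /pair_val -cat_rcons node_val_cat ?size_rcons // node_val_rcons.
by rewrite -(size_rcons C g) cats1 node_val_rcons.
Qed.

Lemma pair_val_cat_not y C g :
  let b := eval y (gate_form (unfold_dag C) g) in
  pair_val y (C ++ [:: g; GNot (size C)]) (size C) = (b, ~~ b).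
Proof. by rewrite pair_val_cat2 /= -/(node_val _ _ _) node_val_rcons. Qed.

Lemma wf_dag_rcons C g :
  wf_dag (rcons C g) <-> wf_dag C /\ all (fun p => p < size C) (children g).
Proof.
split=> [wfCg | [wfC wfg] k h].
  split=> [k h Ck|]; last by apply: wfCg; rewrite -cats1 onth_cat ltnn subnn.
  by apply: wfCg; rewrite -cats1 onth_cat -onthTE Ck.
rewrite -cats1 onth_cat; case: ltnP => [_ /wfC // | le_Ck].
case e: (k - size C) => [|l] /= => [[<-]|]; last by case: l {e}.
by have -> : k = size C by lia.
Qed.

Lemma wf_dag_cat2 C g g' :
  wf_dag C -> all (fun p => p < size C) (children g) ->
  all (fun p => p <= size C) (children g') -> wf_dag (C ++ [:: g; g']).
Proof.
by move=> wfC lt_g lt_g'; rewrite -cat_rcons cats1 !wf_dag_rcons size_rcons.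
Qed.

End NodeValues.

(** * The DAG of the Skolem functions *)

Section SkolemDag.

Variables n m : nat.
Implicit Types (T : seq nat) (C : seq (gate 'I_m)) (D : seq (gate (fvar n m))).
Implicit Types (a b x : 'I_n -> bool) (y : 'I_m -> bool).

(* A node of [D] with formula f becomes a pair of gates, for the positive forms
   of f and of ~ f.  The pair of node p is at [base + 2 * p], that of x_k (for
   x_k and xbar_k) at [nth 0 T k], and the new one at [self]. *)
Definition node_copy T (base self : nat) (g : gate (fvar n m)) : seq (gate 'I_m) :=
  match g with
  | GConst c => [:: GConst c; GNot self]
  | GVar (X k) => let t := nth 0 T k in [:: GAnd t t; GAnd t.+1 t.+1]
  | GVar (Y j) => [:: GVar j; GNot self]
  | GNot p => let q := base + 2 * p + 1 in [:: GAnd q q; GNot self]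
  | GAnd p q => [:: GAnd (base + 2 * p) (base + 2 * q); GNot self]
  | GOr p q => [:: GOr (base + 2 * p) (base + 2 * q); GNot self]
  end.

Definition dag_copy T C D : seq (gate 'I_m) :=
  foldl (fun C' g => C' ++ node_copy T (size C) (size C') g) C D.

Definition hat_pair (f : form (fvar n m)) a b y : bool * bool :=
  (hat_val f a b y, hat_val (FNot f) a b y).

Definition table_ok T C : Prop := size T = n /\ all (fun t => t.+1 < size C) T.

Lemma dag_copy_rcons T C D g :
  dag_copy T C (rcons D g) =
  dag_copy T C D ++ node_copy T (size C) (size (dag_copy T C D)) g.
Proof. exact: foldl_rcons. Qed.

Lemma size_node_copy T base self g : size (node_copy T base self g) = 2.
Proof. by case: g => // -[]. Qed.

Lemma size_dag_copy T C D : size (dag_copy T C D) = size C + 2 * size D.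
Proof.
elim/last_ind: D => [|D g IH]; first by rewrite addn0.
by rewrite dag_copy_rcons size_cat size_node_copy size_rcons IH; lia.
Qed.

Lemma prefix_dag_copy T C D : exists C', dag_copy T C D = C ++ C'.
Proof.
elim/last_ind: D => [|D g [C' IH]]; first by exists [::]; rewrite cats0.
by eexists; rewrite dag_copy_rcons {1}IH -catA.
Qed.

Lemma table_ok_lt T C k : table_ok T C -> k < n -> (nth 0 T k).+1 < size C.
Proof. by case=> sT /(all_nthP 0) okT lt_k; apply: okT; rewrite sT. Qed.

Lemma table_ok_leq T C C' : size C <= size C' -> table_ok T C -> table_ok T C'.
Proof.
by move=> leC [sT okT]; split=> //; apply: sub_all okT => t lt_t; apply: leq_trans leC.
Qed.

Lemma table_ok_set T C i v :
  i < n -> v.+1 < size C -> table_ok T C -> table_ok (set_nth 0 T i v) C.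
Proof.
move=> lt_in lt_v okT; have [sT _] := okT.
have sT' : size (set_nth 0 T i v) = n by rewrite size_set_nth sT; lia.
split=> //; apply/(all_nthP 0) => k; rewrite sT' nth_set_nth /= => lt_k.
by case: eqP => // _; apply: table_ok_lt okT lt_k.
Qed.

Lemma wf_node_copy T C base g :
  wf_dag C -> table_ok T C ->
  all (fun p => base + 2 * p + 1 < size C) (children g) ->
  wf_dag (C ++ node_copy T base (size C) g).
Proof.
move=> wfC okT lt_g; have lt_table (k : 'I_n) := table_ok_lt okT (ltn_ord k).
by case: g lt_g => [c|[k|j]|p|p q|p q] /= lt_g; apply: wf_dag_cat2 => //=;
  try (have := lt_table k); lia.
Qed.

Lemma wf_dag_copy T C D :
  wf_dag C -> table_ok T C -> wf_dag D -> wf_dag (dag_copy T C D).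
Proof.
move=> wfC okT; elim/last_ind: D => [//|D g IH] /wf_dag_rcons [wfD lt_g].
rewrite dag_copy_rcons; apply: wf_node_copy; first exact: IH.
  by apply: table_ok_leq okT; rewrite size_dag_copy leq_addr.
by apply: sub_all lt_g => p lt_p; rewrite size_dag_copy; lia.
Qed.

Lemma pair_val_node_copy T C base g fs a b y :
  table_ok T C ->
  (forall k : 'I_n, pair_val y C (nth 0 T k) = (a k, b k)) ->
  {in children g, forall p,
     pair_val y C (base + 2 * p) = hat_pair (nth (FConst false) fs p) a b y} ->
  pair_val y (C ++ node_copy T base (size C) g) (size C) =
  hat_pair (gate_form fs g) a b y.
Proof.
move=> okT valT valC.
case: g valC => [c|[k|j]|p|p q|p q] valC; rewrite /= ?pair_val_cat_not //=.
3-4: have [val_p _] := valC p (mem_head _ _);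
  have [val_q _] := valC q (mem_last p [:: q]);
  by rewrite -!/(node_val _ _ _) val_p val_q.
- have lt_k := table_ok_lt okT (ltn_ord k).
  rewrite /hat_pair /hat_val /= -(valT k) pair_val_cat2 /= -!/(node_val _ _ _) !andbb.
  by rewrite -cats1 node_val_cat.
- have [_ val_p] := valC p (mem_head _ _).
  by rewrite -addn1 in val_p; rewrite -!/(node_val _ _ _) andbb val_p.
Qed.

Lemma pair_val_dag_copy T C D j a b y :
  table_ok T C -> wf_dag D ->
  (forall k : 'I_n, pair_val y C (nth 0 T k) = (a k, b k)) -> j < size D ->
  pair_val y (dag_copy T C D) (size C + 2 * j) =
  hat_pair (nth (FConst false) (unfold_dag D) j) a b y.
Proof.
move=> okT wfD valT; elim/last_ind: D j wfD => // D g IH j /wf_dag_rcons[wfD lt_g].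
have size_copy := size_dag_copy T C D.
have okT' : table_ok T (dag_copy T C D).
  by apply: table_ok_leq okT; rewrite size_copy leq_addr.
rewrite size_rcons ltnS leq_eqVlt dag_copy_rcons unfold_dag_rcons nth_rcons.
rewrite size_unfold_dag => /predU1P[-> | lt_j]; last first.
  by rewrite lt_j pair_val_cat ?IH // size_copy; lia.
rewrite ltnn eqxx -size_copy; apply: pair_val_node_copy => // [k | p p_g].
  have [C' ->] := prefix_dag_copy T C D.
  by rewrite pair_val_cat ?valT ?(table_ok_lt okT).
by apply: IH => //; apply: (allP lt_g).
Qed.

(* The last two gates make the pair of the new x_i complementary, which that of
   the root of [D] need not be. *)
Definition stage D (i : nat) T C : seq nat * seq (gate 'I_m) :=
  let C' := dag_copy (set_nth 0 T i 1) C D in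
  (set_nth 0 T i (size C'),
   C' ++ [:: GAnd (size C' - 2) (size C' - 2); GNot (size C')]).

Record stage_layout D i T C : Prop := StageLayout {
  layout_table : table_ok T C;
  layout_wf : wf_dag C;
  layout_size : size C = 3 + (n - i) * (2 * size D + 2) }.

Definition initial_dag : seq (gate 'I_m) :=
  [:: GConst true; GConst true; GConst false].

(* The pairs at 0 and 1 are the values (1, 1) and (1, 0) of (x_k, xbar_k) for
   k < i and k = i in alpha_i^10. *)
Definition stage_values i x y T C : Prop :=
  [/\ pair_val y C 0 = (true, true), pair_val y C 1 = (true, false)
    & forall k : 'I_n,
        pair_val y C (nth 0 T k) = ((k < i) || x k, (k < i) || ~~ x k)].

Lemma stage_layout_init D : stage_layout D n (nseq n 0) initial_dag.
Proof.
split=> //=; last by rewrite subnn mul0n.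
- by split; [rewrite size_nseq | rewrite all_nseq orbT].
- by case=> [|[|[|[|k]]]] g //= [<-].
Qed.

Lemma stage_layoutS D i T C :
  0 < size D -> wf_dag D -> i < n -> stage_layout D i.+1 T C ->
  stage_layout D i (stage D i T C).1 (stage D i T C).2.
Proof.
move=> D_gt0 wfD lt_in [okT wfC sizeC].
have okT1 : table_ok (set_nth 0 T i 1) C by apply: table_ok_set; rewrite ?sizeC.
have := wf_dag_copy wfC okT1 wfD; have := size_dag_copy (set_nth 0 T i 1) C D.
rewrite /stage; move: (dag_copy _ C D) => C' sizeC' wfC'; split=> /=.
- apply: table_ok_set; rewrite ?size_cat /= ?addn2 //.
  by apply: table_ok_leq okT; rewrite size_cat; lia.
- by apply: wf_dag_cat2 => //=; lia.
- by rewrite size_cat sizeC' sizeC -(subnSK lt_in) mulSn /=; lia.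
Qed.

Lemma ltnS_neq_ord (i k : 'I_n) : k != i -> (k < i.+1) = (k < i).
Proof. by rewrite ltnS leq_eqVlt val_eqE => /negPf ->. Qed.

Lemma stage_table_val (i : 'I_n) x y T C (k : 'I_n) :
  stage_values i.+1 x y T C ->
  pair_val y C (nth 0 (set_nth 0 T i 1) k) =
  ((k < i) || [eta x with i |-> true] k, (k < i) || ~~ [eta x with i |-> true] k).
Proof.
case=> _ val1 valT; rewrite nth_set_nth /= val_eqE.
by case: (eqVneq k i) => [->|/ltnS_neq_ord <-]; rewrite ?val1 ?valT ?ltnn.
Qed.

Lemma stage_valuesS (F : form (fvar n m)) D (i : 'I_n) x y T C :
  dag_of F D -> stage_layout D i.+1 T C -> stage_values i.+1 x y T C ->
  stage_values i [eta x with i |-> reduct_val F i [eta x with i |-> true] y] y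
    (stage D i T C).1 (stage D i T C).2.
Proof.
move=> [wfD rootF] [okT _ sizeC] valC; have [val0 val1 valT] := valC.
have D_gt0 : 0 < size D by case: (D) rootF.
have okT1 : table_ok (set_nth 0 T i 1) C by apply: table_ok_set; rewrite ?sizeC.
have lt_root : (size D).-1 < size D by rewrite prednK.
have := pair_val_dag_copy okT1 wfD (fun k => stage_table_val k valC) lt_root.
rewrite -odflt_onth rootF /stage.
have -> : size C + 2 * (size D).-1 = size (dag_copy (set_nth 0 T i 1) C D) - 2.
  by rewrite size_dag_copy; lia.
have [C1 ->] := prefix_dag_copy (set_nth 0 T i 1) C D; set C' := C ++ C1.
move=> [val_root _].
have val_old p : p.+1 < size C -> pair_val y (C' ++ _) p = pair_val y C p.
  by move=> lt_p; rewrite -catA pair_val_cat.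
split=> /=; [by rewrite val_old ?sizeC | by rewrite val_old ?sizeC | move=> k].
rewrite nth_set_nth /= val_eqE; case: (eqVneq k i) => [->|/ltnS_neq_ord <-].
  by rewrite ltnn pair_val_cat_not /= -!/(node_val _ _ _) andbb val_root.
by rewrite val_old ?(table_ok_lt okT) // valT.
Qed.

Record skolem_table F D i T C : Prop := SkolemTable {
  skolem_layout : stage_layout D i T C;
  skolem_values : forall y, exists2 x, stage_values i x y T C
    & (exists x', eval (asg x' y) F) -> reduct_val F i x y }.

Lemma skolem_table_init F D :
  is_nnf F -> skolem_table F D n (nseq n 0) initial_dag.
Proof.
move=> nnfF; split=> [|y]; first exact: stage_layout_init.
exists xpred0 => [|[x' Fx']].
  by split=> // k; rewrite nth_nseq if_same ltn_ord.
apply: ex_prefix_reduct_val => //; exists x'; split=> // k.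
by rewrite leqNgt ltn_ord.
Qed.

Lemma skolem_tableS F D (i : 'I_n) T C :
  SynNNF F -> dag_of F D -> skolem_table F D i.+1 T C ->
  skolem_table F D i (stage D i T C).1 (stage D i T C).2.
Proof.
move=> synF dagF [layC valC]; have [wfD rootF] := dagF; split=> [|y].
  by apply: stage_layoutS => //; case: (D) rootF.
have [x val_x solve_x] := valC y.
eexists; first exact: stage_valuesS dagF layC val_x.
by move/solve_x; apply: reduct_val_witness.
Qed.

Lemma skolem_table_is_skolem F D T C :
  skolem_table F D 0 T C -> is_skolem F (dag_fun C T).
Proof.
case=> _ valC y; have [x [_ _ val_x] solve_x] := valC y.
split=> [/solve_x | Fpsi]; last by exists (fun k => dag_fun C T k y).
have psiE k : dag_fun C T k y = x k by case: (val_x k).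
rewrite -hat_val_negb (eq_hat_val F (a' := x) (b' := negb \o x)) // => k /=.
by rewrite psiE.
Qed.

End SkolemDag.

(** * Structured programs *)

Inductive expr : Type :=
  | Const of nat
  | Reg of nat
  | Plus of nat & nat
  | Minus of nat & nat
  | Cell of nat.

Inductive cmd : Type :=
  | Skip
  | Assign of nat & expr
  | Store of nat & nat
  | Seq of cmd & cmd
  | IfZero of nat & cmd & cmd
  | While of nat & cmd.

Notation "r ::= e" := (Assign r e) (at level 60).
Notation "c1 ;; c2" := (Seq c1 c2) (at level 70, right associativity).

Definition compile_assign (r : nat) (e : expr) : instr :=
  match e with
  | Const v => IConst r v
  | Reg a => IMove r a
  | Plus a b => IAdd r a b
  | Minus a b => ISub r a b
  | Cell a => ILoad r a
  end.

(* Jump targets are absolute: [p] is the position of the code of [c]. *)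
Fixpoint compile (p : nat) (c : cmd) : seq instr :=
  match c with
  | Skip => [::]
  | r ::= e => [:: compile_assign r e]
  | Store a b => [:: IStore a b]
  | c1 ;; c2 => let s1 := compile p c1 in s1 ++ compile (p + size s1) c2
  | IfZero a c1 c2 =>
      let s2 := compile p.+1 c2 in
      let l1 := (p.+1 + size s2).+1 in
      let s1 := compile l1 c1 in
      IJumpZ a l1 :: s2 ++ IJump (l1 + size s1) :: s1
  | While a c1 =>
      let s1 := compile p.+1 c1 in
      IJumpZ a (p.+1 + size s1).+1 :: s1 ++ [:: IJump p]
  end.

Definition code_at (P : seq instr) (p : nat) (s : seq instr) : Prop :=
  forall k, k < size s -> onth P (p + k) = onth s k.

Lemma code_at_cons P p i s :
  code_at P p (i :: s) -> onth P p = Some i /\ code_at P p.+1 s.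
Proof.
move=> h; split; first by rewrite -[p]addn0 h.
by move=> k lt_k; rewrite addSnnS h.
Qed.

Lemma code_at_cat P p s1 s2 :
  code_at P p (s1 ++ s2) -> code_at P p s1 /\ code_at P (p + size s1) s2.
Proof.
rewrite /code_at size_cat => h.
split=> k lt_k; rewrite -?addnA h ?ltn_add2l ?onth_cat ?lt_k ?ltn_addr //.
by rewrite ltnNge leq_addr addKn.
Qed.

Definition value (R : nat -> nat) (M : seq nat) (e : expr) : nat :=
  match e with
  | Const v => v
  | Reg a => R a
  | Plus a b => R a + R b
  | Minus a b => R a - R b
  | Cell a => nth 0 M (R a)
  end.

Definition in_bounds (R : nat -> nat) (M : seq nat) (e : expr) : bool :=
  if e is Cell a then R a < size M else true.

Section Execution.

Variable W : nat.
Implicit Types (R : nat -> nat) (M : seq nat) (Q : (nat -> nat) -> seq nat -> Prop).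

Definition arrives P (t : nat) (s : config) (p : nat) Q : Prop :=
  exists k R M, [/\ k <= t, run P W k s = Some (Config p R M) & Q R M].

Definition reaches (t : nat) (c : cmd) R M Q : Prop :=
  forall P p, code_at P p (compile p c) ->
  arrives P t (Config p R M) (p + size (compile p c)) Q.

Lemma arrives_now P t p R M Q : Q R M -> arrives P t (Config p R M) p Q.
Proof. by exists 0, R, M. Qed.

Lemma arrives_step P t s s' p Q :
  step P W s = Some s' -> arrives P t s' p Q -> arrives P t.+1 s p Q.
Proof.
by move=> stepE [k [R [M [le_k runE QRM]]]]; exists k.+1, R, M; rewrite /= stepE.
Qed.

Lemma arrives_trans P t1 t2 s p1 p2 Q :
  arrives P t1 s p1 (fun R M => arrives P t2 (Config p1 R M) p2 Q) ->
  arrives P (t1 + t2) s p2 Q.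
Proof.
move=> [k1 [R1 [M1 [le1 run1 [k2 [R2 [M2 [le2 run2 QRM]]]]]]]].
exists (k1 + k2), R2, M2; split; rewrite ?leq_add //.
elim: k1 s run1 {le1} => [s [->] // | k1 IH s] /=.
by case: step => //= s'; apply: IH.
Qed.

Lemma reaches_skip R M Q : Q R M -> reaches 0 Skip R M Q.
Proof. by move=> QR P p _; rewrite addn0; apply: arrives_now. Qed.

Lemma reaches_assign r e R M Q :
  in_bounds R M e -> value R M e < W -> Q [eta R with r |-> value R M e] M ->
  reaches 1 (r ::= e) R M Q.
Proof.
move=> inM ltW QR P p /code_at_cons[Pp _].
apply: (@arrives_step _ _ _ (Config p.+1 [eta R with r |-> value R M e] M)).
  rewrite /step /= Pp; case: e inM ltW {QR Pp} => [v|a|a b|a b|a] /= inM ltW;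
    rewrite /set_reg ?ltW //.
  rewrite -(odflt_onth 0) in ltW *; move: inM ltW; rewrite -onthTE.
  by case: onth => //= v _ ->.
by rewrite addn1; apply: arrives_now.
Qed.

Lemma reaches_store a b R M Q :
  R a < size M -> Q R (set_nth 0 M (R a) (R b)) -> reaches 1 (Store a b) R M Q.
Proof.
move=> ltM QR P p /code_at_cons[Pp _].
apply: (@arrives_step _ _ _ (Config p.+1 R (set_nth 0 M (R a) (R b)))).
  by rewrite /step /= Pp ltM.
by rewrite addn1; apply: arrives_now.
Qed.

Lemma reaches_seq t1 t2 c1 c2 R M Q :
  reaches t1 c1 R M (fun R' M' => reaches t2 c2 R' M' Q) ->
  reaches (t1 + t2) (c1 ;; c2) R M Q.
Proof.
move=> h P p /= /code_at_cat[/h [k [R' [M' [le_k runE h']]]] code2].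
apply: (@arrives_trans _ _ _ _ (p + size (compile p c1))).
by exists k, R', M'; split=> //; rewrite size_cat addnA; apply: h'.
Qed.

Lemma reaches_if_zero t a c1 c2 R M Q :
  R a = 0 -> reaches t c1 R M Q -> reaches t.+1 (IfZero a c1 c2) R M Q.
Proof.
move=> Ra0 h P p /= /code_at_cons[Pp /code_at_cat[_ /code_at_cons[_ /h code1]]].
apply: arrives_step; first by rewrite /step /= Pp Ra0.
by rewrite size_cat /= !addnS addnA in code1 *.
Qed.

Lemma reaches_if_pos t a c1 c2 R M Q :
  0 < R a -> reaches t c2 R M Q -> reaches t.+2 (IfZero a c1 c2) R M Q.
Proof.
move=> /lt0n_neq0/negPf Ra_gt0 h P p /=.
move=> /code_at_cons[Pp /code_at_cat[/h code2 /code_at_cons[Pjump _]]].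
apply: arrives_step; first by rewrite /step /= Pp Ra_gt0.
rewrite -addn1; apply: arrives_trans; case: code2 => [k [R' [M' [le_k runE QR]]]].
exists k, R', M'; split; [exact: le_k | exact: runE | apply: arrives_step].
  by rewrite /step [onth _ _]Pjump.
by rewrite size_cat /= !addnS addnA; apply: arrives_now.
Qed.

Lemma reaches_while_zero a c R M Q : R a = 0 -> Q R M -> reaches 1 (While a c) R M Q.
Proof.
move=> Ra0 QR P p /= /code_at_cons[Pp _].
apply: arrives_step; first by rewrite /step /= Pp Ra0.
by rewrite size_cat /= addn1 !addnS; apply: arrives_now.
Qed.

Lemma reaches_while_pos t1 t2 a c R M Q :
  0 < R a -> reaches t1 c R M (fun R' M' => reaches t2 (While a c) R' M' Q) ->
  reaches (t1.+2 + t2) (While a c) R M Q.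
Proof.
move=> /lt0n_neq0/negPf Ra_gt0 h P p code_while; rewrite addSn.
have /= /code_at_cons[Pp /code_at_cat[/h [k [R' [M' [le_k runE h']]]]]] := code_while.
move=> /code_at_cons[Pjump _].
apply: arrives_step; first by rewrite /step /= Pp Ra_gt0.
rewrite addSnnS; apply: arrives_trans; exists k, R', M'; split; first by [].
  exact: runE.
by apply: arrives_step; [rewrite /step [onth _ _]Pjump | apply: h'].
Qed.

Lemma reaches_weaken t t' c R M Q Q' :
  t <= t' -> (forall R' M', Q R' M' -> Q' R' M') ->
  reaches t c R M Q -> reaches t' c R M Q'.
Proof.
move=> le_t QQ' h P p /h [k [R' [M' [le_k runE QR]]]].
by exists k, R', M'; split; [apply: leq_trans le_t | | apply: QQ'].
Qed.

Lemma reaches_while (I : nat -> (nat -> nat) -> seq nat -> Prop) t a c d R M :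
  (forall k R' M', I k R' M' -> R' a = k) ->
  (forall k R' M', I k.+1 R' M' -> reaches t c R' M' (I k)) ->
  I d R M -> reaches (d * t.+2 + 1) (While a c) R M (I 0).
Proof.
move=> Ia Ic; elim: d R M => [|d IH] R M IR.
  by apply: reaches_while_zero => //; apply: Ia IR.
rewrite mulSn -addnA; apply: reaches_while_pos; first by rewrite (Ia _ _ _ IR).
by apply: reaches_weaken (Ic _ _ _ IR) => // R' M'; apply: IH.
Qed.

(* [wp] and [cost] are meant for loop-free commands: on a loop, [wp] is false and
   [cost] is 0. *)
Fixpoint wp (c : cmd) R M Q : Prop :=
  match c with
  | Skip => Q R M
  | r ::= e =>
      [/\ in_bounds R M e, value R M e < W & Q [eta R with r |-> value R M e] M]
  | Store a b => R a < size M /\ Q R (set_nth 0 M (R a) (R b))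
  | c1 ;; c2 => wp c1 R M (fun R' M' => wp c2 R' M' Q)
  | IfZero a c1 c2 => if R a == 0 then wp c1 R M Q else wp c2 R M Q
  | While _ _ => False
  end.

Fixpoint cost (c : cmd) : nat :=
  match c with
  | Skip => 0
  | _ ::= _ | Store _ _ => 1
  | c1 ;; c2 => cost c1 + cost c2
  | IfZero _ c1 c2 => (maxn (cost c1) (cost c2).+1).+1
  | While _ _ => 0
  end.

Lemma wp_mono c R M Q Q' :
  (forall R' M', Q R' M' -> Q' R' M') -> wp c R M Q -> wp c R M Q'.
Proof.
elim: c R M Q Q' => /= [|r e|a b|c1 IH1 c2 IH2|a c1 IH1 c2 IH2|//] R M Q Q' QQ'.
- exact: QQ'.
- by case=> *; split=> //; apply: QQ'.
- by case=> *; split=> //; apply: QQ'.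
- by apply: IH1 => R' M'; apply: IH2.
- by case: eqP => _; [apply: IH1 | apply: IH2].
Qed.

Lemma reaches_wp c R M Q : wp c R M Q -> reaches (cost c) c R M Q.
Proof.
elim: c R M Q => /= [|r e|a b|c1 IH1 c2 IH2|a c1 IH1 c2 IH2|//] R M Q.
- exact: reaches_skip.
- by case; apply: reaches_assign.
- by case; apply: reaches_store.
- by move=> h; apply/reaches_seq/IH1; apply: wp_mono h => R' M'; apply: IH2.
case: eqP => [Ra0 /IH1 | /eqP]; last rewrite -lt0n => Ra_gt0 /IH2.
  by move/(reaches_if_zero (c2 := c2) Ra0); apply: reaches_weaken => //; lia.
by move/(reaches_if_pos (c1 := c1) Ra_gt0); apply: reaches_weaken => //; lia.
Qed.

Lemma wp_seq c1 c2 R M Q :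
  wp c1 R M (fun R' M' => wp c2 R' M' Q) -> wp (c1 ;; c2) R M Q.
Proof. by []. Qed.

Lemma wp_assign r e c R M Q :
  in_bounds R M e -> value R M e < W ->
  wp c [eta R with r |-> value R M e] M Q -> wp (r ::= e ;; c) R M Q.
Proof. by []. Qed.

Lemma computes_compile c t s inp post :
  size inp <= s -> all (fun w => w < W) inp ->
  reaches t c (fun=> 0) (inp ++ nseq (s - size inp) 0)
    (fun R M => forall p, post (Config p R M)) ->
  computes (compile 0 c ++ [:: IHalt]) W t s inp post.
Proof.
move=> le_s inpW /(_ (compile 0 c ++ [:: IHalt]) 0).
case=> [k lt_k|k [R [M [le_k runE postR]]]].
  by rewrite onth_cat lt_k.
split=> //; exists k, (Config (size (compile 0 c)) R M); split=> //.
by rewrite onth_cat ltnn subnn.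
Qed.

End Execution.

(** * Memory layout *)

Definition pad (cells : nat) (s : seq nat) : seq nat := s ++ nseq (cells - size s) 0.

Lemma size_pad cells s : size s <= cells -> size (pad cells s) = cells.
Proof. by move=> le_s; rewrite size_cat size_nseq subnKC. Qed.

Lemma nth_pad cells s a : nth 0 (pad cells s) a = nth 0 s a.
Proof.
by rewrite nth_cat nth_nseq if_same; case: ltnP => // /(nth_default 0) ->.
Qed.

Lemma pad_cat_nseq cells s k :
  size s + k <= cells -> pad cells (s ++ nseq k 0) = pad cells s.
Proof.
move=> le_cells; rewrite /pad -catA -nseqD size_cat size_nseq.
by congr (_ ++ nseq _ 0); lia.
Qed.

Lemma set_nth_cat (T : Type) (x0 : T) (s1 s2 : seq T) (a : nat) (v : T) :
  set_nth x0 (s1 ++ s2) a v =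
  if a < size s1 then set_nth x0 s1 a v ++ s2 else s1 ++ set_nth x0 s2 (a - size s1) v.
Proof. by elim: s1 a => [|x s1 IH] [|a] //=; rewrite IH ltnS; case: ifP. Qed.

Lemma set_nth_pad cells s a v :
  a < size s -> set_nth 0 (pad cells s) a v = pad cells (set_nth 0 s a v).
Proof.
by move=> lt_a; rewrite /pad set_nth_cat lt_a size_set_nth (maxn_idPr lt_a).
Qed.

Lemma set_nth_pad_end cells s v :
  size s < cells -> set_nth 0 (pad cells s) (size s) v = pad cells (rcons s v).
Proof.
move=> lt_s; rewrite /pad set_nth_cat ltnn subnn size_rcons cat_rcons.
by rewrite -(subnSK lt_s).
Qed.

Lemma slice_cat (s1 s2 s3 : seq nat) :
  slice (size s1) (size s2) (s1 ++ s2 ++ s3) = s2.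
Proof. by rewrite /slice drop_size_cat // take_size_cat. Qed.

Section Encodings.

Variables (V : Type) (ev : V -> seq nat).
Hypothesis size_ev : forall v, size (ev v) = 2.
Implicit Types (g : gate V) (D : seq (gate V)).

Lemma size_enc_gate g : size (enc_gate ev g) = 3.
Proof. by case: g => //= v; rewrite size_ev. Qed.

Lemma enc_gate_words g : exists w0 w1 w2, enc_gate ev g = [:: w0; w1; w2].
Proof.
case: (enc_gate ev g) (size_enc_gate g) => [|w0 [|w1 [|w2 []]]] // _.
by exists w0, w1, w2.
Qed.

Lemma enc_dag_cat D1 D2 : enc_dag ev (D1 ++ D2) = enc_dag ev D1 ++ enc_dag ev D2.
Proof. by rewrite /enc_dag map_cat flatten_cat. Qed.

Lemma enc_dag_rcons D g : enc_dag ev (rcons D g) = enc_dag ev D ++ enc_gate ev g.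
Proof. by rewrite -cats1 enc_dag_cat /enc_dag /= cats0. Qed.

Lemma size_enc_dag D : size (enc_dag ev D) = 3 * size D.
Proof.
elim/last_ind: D => // D g IH.
by rewrite enc_dag_rcons size_cat IH size_enc_gate size_rcons mulnS addnC.
Qed.

Lemma nth_enc_dag D1 g D2 w :
  w < 3 ->
  nth 0 (enc_dag ev (D1 ++ g :: D2)) (3 * size D1 + w) = nth 0 (enc_gate ev g) w.
Proof.
move=> lt_w; rewrite -cat_rcons enc_dag_cat enc_dag_rcons -catA nth_cat size_enc_dag.
by rewrite ltnNge leq_addr addKn nth_cat size_enc_gate lt_w.
Qed.

End Encodings.

Lemma size_enc_fvar n m (v : fvar n m) : size (enc_fvar v) = 2.
Proof. by case: v. Qed.

Lemma size_enc_problem n m (D : seq (gate (fvar n m))) :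
  size (enc_problem D) = 3 + 3 * size D.
Proof. by rewrite size_cat size_enc_dag //; apply: size_enc_fvar. Qed.

Lemma enc_problem_bound n m (D : seq (gate (fvar n m))) W :
  wf_dag D -> n + m + size D + 5 <= W -> all (fun w => w < W) (enc_problem D).
Proof.
move=> wfD leW; rewrite all_cat /=; apply/andP; split; first by apply/and4P; split; lia.
elim/last_ind: D wfD leW => // D g IH /wf_dag_rcons[wfD lt_g].
rewrite size_rcons => leW; rewrite enc_dag_rcons all_cat IH //; last by lia.
by case: g lt_g => [[]|[k|j]|p|p q|p q] /=;
  try have := ltn_ord k; try have := ltn_ord j; lia.
Qed.

(** * The program *)

(* The output format fixes registers 0 to 2, the table being the output table.
   [rTag], [rFst], [rSnd] hold the gate to be emitted, and their primed versions
   the second gate of the pair; [rStage] is the number of copies still to be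
   made, [rTodo] the number of nodes still missing from the current copy, and
   [rBase] the position where that copy starts. *)
Local Notation rDag := 0 (only parsing).
Local Notation rCount := 1 (only parsing).
Local Notation rTable := 2 (only parsing).
Local Notation rOne := 3 (only parsing).
Local Notation rNodes := 4 (only parsing).
Local Notation rStage := 5 (only parsing).
Local Notation rTodo := 6 (only parsing).
Local Notation rRead := 7 (only parsing).
Local Notation rWrite := 8 (only parsing).
Local Notation rBase := 9 (only parsing).
Local Notation rTag := 10 (only parsing).
Local Notation rFst := 11 (only parsing).
Local Notation rSnd := 12 (only parsing).
Local Notation rTag' := 13 (only parsing).
Local Notation rFst' := 14 (only parsing).
Local Notation rSnd' := 15 (only parsing).
Local Notation rTmp := 16 (only parsing).

Definition write_word (r : nat) : cmd :=
  Store rWrite r ;; rWrite ::= Plus rWrite rOne.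

Definition emit : cmd :=
  write_word rTag ;; write_word rFst ;; write_word rSnd ;; rCount ::= Plus rCount rOne.

Definition emit_pair : cmd :=
  emit ;; rTag ::= Reg rTag' ;; rFst ::= Reg rFst' ;; rSnd ::= Reg rSnd' ;; emit.

Definition read_word (r : nat) : cmd :=
  r ::= Cell rRead ;; rRead ::= Plus rRead rOne.

Definition fetch : cmd := read_word rTag ;; read_word rFst ;; read_word rSnd.

Definition prepare_not : cmd :=
  rTag' ::= Const 2 ;; rFst' ::= Reg rCount ;; rSnd' ::= Const 0.

Definition relocate (r : nat) : cmd := rTmp ::= Plus r r ;; r ::= Plus rBase rTmp.

Definition translate_output : cmd :=
  rTmp ::= Plus rTable rSnd ;;
  rTag ::= Const 3 ;; rFst ::= Cell rTmp ;; rSnd ::= Reg rFst ;;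
  rTag' ::= Const 3 ;; rFst' ::= Plus rFst rOne ;; rSnd' ::= Reg rFst'.

Definition translate_not : cmd :=
  rTag ::= Const 3 ;; relocate rFst ;; rFst ::= Plus rFst rOne ;; rSnd ::= Reg rFst.

Definition translate : cmd :=
  prepare_not ;;
  IfZero rTag Skip
    (rTmp ::= Minus rTag rOne ;;
     IfZero rTmp (IfZero rFst translate_output Skip)
       (rTmp ::= Minus rTmp rOne ;;
        IfZero rTmp translate_not (relocate rFst ;; relocate rSnd))).

Definition copy_node : cmd :=
  fetch ;; translate ;; emit_pair ;; rTodo ::= Minus rTodo rOne.

Definition open_stage : cmd :=
  rStage ::= Minus rStage rOne ;; rTmp ::= Plus rTable rStage ;; Store rTmp rOne ;;
  rBase ::= Reg rCount ;; rRead ::= Const 3 ;; rTodo ::= Reg rNodes.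

Definition record_root : cmd :=
  rTmp ::= Plus rTable rStage ;; Store rTmp rCount ;; prepare_not ;;
  rTag ::= Const 3 ;; rFst ::= Minus rCount rOne ;; rFst ::= Minus rFst rOne ;;
  rSnd ::= Reg rFst.

Definition close_stage : cmd := record_root ;; emit_pair.

(* All registers are initially 0; in particular [rTmp] is the address of n. *)
Definition init_registers : cmd :=
  rOne ::= Const 1 ;;
  rStage ::= Cell rTmp ;; rTmp ::= Const 2 ;; rNodes ::= Cell rTmp ;;
  rTable ::= Const 3 ;; rTable ::= Plus rTable rNodes ;;
  rTable ::= Plus rTable rNodes ;; rTable ::= Plus rTable rNodes ;;
  rDag ::= Plus rTable rStage ;; rWrite ::= Reg rDag ;; rFst ::= Const 1.

Definition setup : cmd :=
  init_registers ;; emit ;; emit ;; rFst ::= Const 0 ;; emit.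

Definition stage_cmd : cmd := open_stage ;; While rTodo copy_node ;; close_stage.

Definition skolem_cmd : cmd := setup ;; While rStage stage_cmd.

Definition stage_cost (N : nat) : nat :=
  cost open_stage + (N * (cost copy_node).+2 + 1 + cost close_stage).

(** * Correctness of the program *)

Section Correctness.

Variables (n m : nat) (D : seq (gate (fvar n m))) (W cells : nat).

Definition capacity : nat := 3 + n * (2 * size D + 2).

Lemma capacity_ge3 : 3 <= capacity.
Proof. by []. Qed.

Hypothesis fit_cells : 3 + 3 * size D + n + 3 * capacity <= cells.
Hypothesis fit_word : cells + m < W.
Implicit Types (T : seq nat) (C : seq (gate 'I_m)) (R : nat -> nat) (M : seq nat).
Implicit Types (Q : (nat -> nat) -> seq nat -> Prop).

Definition contents T C : seq nat :=
  enc_problem D ++ T ++ enc_dag (@enc_input_var m) C.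

(* Registers from [rTag] on are scratch. *)
Definition state_kept R R' : Prop := forall k, k < rTag -> R' k = R k.

Lemma state_kept_set R R' r v :
  rTag <= r -> state_kept R R' -> state_kept R [eta R' with r |-> v].
Proof. by move=> le_r kept k lt_k; rewrite /= ltn_eqF ?kept // (leq_trans lt_k). Qed.

Record machine_inv T C R M : Prop := MachineInv {
  inv_one : R rOne = 1;
  inv_nodes : R rNodes = size D;
  inv_table : R rTable = 3 + 3 * size D;
  inv_dag : R rDag = 3 + 3 * size D + n;
  inv_count : R rCount = size C;
  inv_write : R rWrite = 3 + 3 * size D + n + 3 * size C;
  inv_table_size : size T = n;
  inv_capacity : size C <= capacity;
  inv_mem : M = pad cells (contents T C) }.

Definition gate_pair_ready R (g g' : gate 'I_m) : Prop :=
  [/\ enc_gate (@enc_input_var m) g = [:: R rTag; R rFst; R rSnd],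
      enc_gate (@enc_input_var m) g' = [:: R rTag'; R rFst'; R rSnd']
    & all (fun w => w < W) (enc_gate (@enc_input_var m) g')].

Lemma machine_inv_kept T C R R' M :
  state_kept R R' -> machine_inv T C R M -> machine_inv T C R' M.
Proof. by move=> kept []; split; rewrite ?kept. Qed.

Lemma size_contents T C :
  size T = n -> size (contents T C) = 3 + 3 * size D + n + 3 * size C.
Proof. by move=> sT; rewrite 2!size_cat size_enc_problem sT size_enc_dag // addnA. Qed.

Lemma wp_write_word r s R Q :
  R rOne = 1 -> R rWrite = size s -> size s < cells ->
  Q [eta R with rWrite |-> R rWrite + 1] (pad cells (rcons s (R r))) ->
  wp W (write_word r) R (pad cells s) Q.
Proof.
move=> oneR writeR lt_s QR; rewrite /write_word /= oneR writeR size_pad ?(ltnW lt_s) //.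
by rewrite set_nth_pad_end //; split=> //; split; rewrite -?writeR //; lia.
Qed.

Lemma wp_emit T C g R M Q :
  machine_inv T C R M -> size C < capacity ->
  enc_gate (@enc_input_var m) g = [:: R rTag; R rFst; R rSnd] ->
  (forall R' M', machine_inv T (rcons C g) R' M' ->
     {in [predC [:: rWrite; rCount]], R' =1 R} -> Q R' M') ->
  wp W emit R M Q.
Proof.
move=> [oneR nodesR tableR dagR countR writeR sT _ ->] lt_C enc_g QR.
have sC := size_contents C sT.
have fit : 3 * size C + 3 <= 3 * capacity by lia.
rewrite /emit; apply/wp_seq/wp_write_word; rewrite ?sC //; first by lia.
do 2 (apply/wp_seq/wp_write_word; rewrite ?size_rcons ?sC //;
  [by rewrite /= writeR; lia | by lia |]).
split=> //=; first by lia.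
apply: QR => [|k]; last by rewrite !inE negb_or /= => /andP[/negPf-> /negPf->].
split=> //=; rewrite ?size_rcons ?countR ?oneR ?addn1 //; first by lia.
by rewrite /contents enc_dag_rcons enc_g -!cats1 -!catA.
Qed.

Lemma wp_emit_pair T C g g' R M Q :
  machine_inv T C R M -> size C + 2 <= capacity ->
  gate_pair_ready R g g' ->
  (forall R' M', machine_inv T (C ++ [:: g; g']) R' M' ->
     {in [:: rStage; rTodo; rRead; rBase], R' =1 R} -> Q R' M') ->
  wp W emit_pair R M Q.
Proof.
move=> okR le_C [enc_g enc_g' lt_g'] QR; rewrite /emit_pair.
apply/wp_seq/(wp_emit okR _ enc_g) => [|R1 M1 okR1 eq_R1]; first by lia.
move: lt_g'; rewrite enc_g' => /and4P[lt_op lt_l lt_r _].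
have eq_op : R1 rTag' = R rTag' by apply: eq_R1.
have eq_l : R1 rFst' = R rFst' by apply: eq_R1.
have eq_r : R1 rSnd' = R rSnd' by apply: eq_R1.
apply: wp_assign; [by [] | by rewrite /= eq_op |]; rewrite [value _ _ _]/= eq_op.
apply: wp_assign; [by [] | by rewrite /= eq_l |]; rewrite [value _ _ _]/= eq_l.
apply: wp_assign; [by [] | by rewrite /= eq_r |]; rewrite [value _ _ _]/= eq_r.
have okR2 : machine_inv T (rcons C g)
    [eta [eta [eta R1 with rTag |-> R rTag'] with rFst |-> R rFst']
       with rSnd |-> R rSnd'] M1.
  by case: okR1.
apply: (wp_emit okR2) enc_g' _ => [|R' M']; first by rewrite size_rcons; lia.
rewrite -!cats1 -catA => okR' eq_R'; apply: QR => // k k_in.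
by move: k_in (eq_R' k) (eq_R1 k); rewrite !inE => /or4P[]/eqP-> /= -> // ->.
Qed.

Hypothesis wfD : wf_dag D.

Lemma nth_contents_input T C D1 g D2 w :
  D = D1 ++ g :: D2 -> w < 3 ->
  nth 0 (contents T C) (3 + 3 * size D1 + w) = nth 0 (enc_gate (@enc_fvar n m) g) w.
Proof.
move=> defD lt_w; rewrite -addnA nth_cat size_enc_problem {1}defD size_cat.
rewrite ifT -1?[LHS]/(nth 0 (enc_dag (@enc_fvar n m) D) (3 * size D1 + w)).
  by rewrite {1}defD nth_enc_dag //; apply: size_enc_fvar.
by rewrite /=; lia.
Qed.

Lemma enc_gate_lt_word D1 g D2 :
  D = D1 ++ g :: D2 -> all (fun w => w < W) (enc_gate (@enc_fvar n m) g).
Proof.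
move=> defD; have : all (fun w => w < W) (enc_problem D).
  by apply: enc_problem_bound => //; move: fit_cells; rewrite /capacity; lia.
rewrite all_cat => /andP[_]; rewrite defD -cat_rcons enc_dag_cat enc_dag_rcons.
by rewrite !all_cat => /andP[/andP[_ ->]].
Qed.

Lemma wp_fetch T C D1 g D2 R M Q :
  D = D1 ++ g :: D2 -> machine_inv T C R M -> R rRead = 3 + 3 * size D1 ->
  (forall R', machine_inv T C R' M -> R' rRead = 3 + 3 * (size D1).+1 ->
     enc_gate (@enc_fvar n m) g = [:: R' rTag; R' rFst; R' rSnd] ->
     {in [:: rStage; rTodo; rBase], R' =1 R} -> Q R' M) ->
  wp W fetch R M Q.
Proof.
move=> defD okR readR QR; have [oneR _ _ _ _ _ sT le_C eM] := okR.
have [w0 [w1 [w2 enc_g]]] := enc_gate_words (@size_enc_fvar n m) g.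
have := enc_gate_lt_word defD; rewrite enc_g => /and4P[lt_w0 lt_w1 lt_w2 _].
have sM : size M = cells by rewrite eM size_pad // size_contents //; lia.
have lt_D1 : size D1 < size D by rewrite defD size_cat /=; lia.
pose a := 3 + 3 * size D1.
have readM k w : k = a + w -> w < 3 -> nth 0 M k = nth 0 [:: w0; w1; w2] w.
  by move=> -> lt_w; rewrite eM nth_pad (nth_contents_input _ _ defD) // enc_g.
have [read0 read1 read2] :
    [/\ nth 0 M a = w0, nth 0 M (a + 1) = w1 & nth 0 M (a + 1 + 1) = w2].
  by split; [rewrite (@readM _ 0) | rewrite (@readM _ 1) | rewrite (@readM _ 2)];
    rewrite //; lia.
rewrite /fetch /read_word /= readR oneR -/a read0 read1 read2.
do 6 (split; [by [] || by lia | by [] || by lia |]).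
apply: QR => //=; first by case: okR.
  by lia.
by move=> k; rewrite !inE => /or3P[]/eqP->.
Qed.

Lemma nth_contents_table T C k :
  k < size T -> nth 0 (contents T C) (3 + 3 * size D + k) = nth 0 T k.
Proof.
by move=> lt_k; rewrite nth_cat size_enc_problem ltnNge leq_addr addKn nth_cat lt_k.
Qed.

Lemma wp_translate T C g R M Q :
  machine_inv T C R M -> table_ok n T C ->
  all (fun p => R rBase + 2 * p + 1 < size C) (children g) ->
  enc_gate (@enc_fvar n m) g = [:: R rTag; R rFst; R rSnd] ->
  (forall R' g1 g2, machine_inv T C R' M ->
     node_copy T (R rBase) (size C) g = [:: g1; g2] ->
     gate_pair_ready R' g1 g2 -> state_kept R R' -> Q R' M) ->
  wp W translate R M Q.
Proof.
move=> okR okT lt_g enc_g QR.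
have [oneR _ tableR _ countR _ sT le_C eM] := okR.
have lt_C : size C + 5 < W by have := capacity_ge3; lia.
have translated R' g1 g2 : state_kept R R' ->
    node_copy T (R rBase) (size C) g = [:: g1; g2] -> gate_pair_ready R' g1 g2 ->
    Q R' M.
  by move=> kept copyE ready; apply: QR (machine_inv_kept kept okR) copyE ready kept.
rewrite /translate /translate_output /translate_not /relocate /= countR oneR.
case: g lt_g enc_g translated {QR} =>
  [c|[k|j]|p|p q|p q] /= lt_g [eTag eFst eSnd] translated;
  rewrite -eTag /=.
5-6: case/and3P: lt_g => lt_p lt_q _; do !(split; [by [] | by lia |]);
  apply: translated => //=; first (by do !apply: state_kept_set);
  by split=> //=; [rewrite -eTag -eFst -eSnd !mul2n -!addnn | lia].
- do !(split; [by [] | by lia |]).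
  apply: translated => //=; first by do !apply: state_kept_set.
  by split=> //=; [rewrite -eTag -eFst -eSnd | lia].
- have lt_k := ltn_ord k; have lt_t := table_ok_lt okT lt_k.
  have sM : size M = cells by rewrite eM size_pad // size_contents //; lia.
  have loadT : nth 0 M (R rTable + R rSnd) = nth 0 T k.
    by rewrite tableR -eSnd eM nth_pad nth_contents_table // sT.
  rewrite -eFst /= loadT; do !(split; [by [] || by lia | by lia |]).
  apply: translated => //=; first by do !apply: state_kept_set.
  by split=> //=; [rewrite addn1 | lia].
- rewrite -eFst /=; do !(split; [by [] | by lia |]).
  apply: translated => //=; first by do !apply: state_kept_set.
  by split=> //=; [rewrite -eTag -eFst -eSnd | lia].
- have lt_p : R rBase + 2 * p + 1 < size C by case/andP: lt_g.
  do !(split; [by [] | by lia |]).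
  apply: translated => //=; first by do !apply: state_kept_set.
  by split=> //=; [rewrite -eFst mul2n -addnn | lia].
Qed.

Lemma wp_copy_node T C D1 g D2 R M Q :
  D = D1 ++ g :: D2 -> machine_inv T C R M -> table_ok n T C ->
  R rRead = 3 + 3 * size D1 -> R rBase + 2 * size D1 = size C ->
  size C + 2 <= capacity -> R rTodo < W ->
  (forall R' M', machine_inv T (C ++ node_copy T (R rBase) (size C) g) R' M' ->
     R' rRead = 3 + 3 * (size D1).+1 -> R' rTodo = R rTodo - 1 ->
     {in [:: rStage; rBase], R' =1 R} -> Q R' M') ->
  wp W copy_node R M Q.
Proof.
move=> defD okR okT readR baseR le_C lt_todo QR; rewrite /copy_node.
have lt_g : all (fun p => R rBase + 2 * p + 1 < size C) (children g).
  have := wfD (k := size D1) (g := g); rewrite defD onth_cat ltnn subnn => /(_ erefl).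
  by apply: sub_all => p; lia.
apply/wp_seq/(wp_fetch defD okR readR) => R1 okR1 readR1 enc_g eq_R1.
rewrite -(eq_R1 rBase) // in lt_g.
apply/wp_seq/(wp_translate okR1 okT lt_g enc_g) => R2 g1 g2 okR2 copyE ready keptR2.
apply/wp_seq/(wp_emit_pair okR2 le_C ready) => R3 M3 okR3 eq_R3.
have todoR3 : R3 rTodo = R rTodo by rewrite eq_R3 // keptR2 // eq_R1.
have [oneR3 _ _ _ _ _ _ _ _] := okR3.
split=> //=; rewrite todoR3 oneR3; first by lia.
apply: QR => //=.
- rewrite eq_R1 // in copyE; rewrite copyE.
  by case: okR3; split.
- by rewrite eq_R3 ?keptR2.
by move=> k; rewrite !inE => /orP[]/eqP-> /=; rewrite eq_R3 // keptR2 // eq_R1.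
Qed.

Definition copy_inv T C i d R M : Prop :=
  exists D1 D2, [/\ D = D1 ++ D2, size D2 = d, machine_inv T (dag_copy T C D1) R M
    & [/\ R rStage = i, R rBase = size C, R rRead = 3 + 3 * size D1 & R rTodo = d]].

Lemma reaches_copy_node T C i d R M :
  table_ok n T C -> size C + 2 * size D <= capacity -> copy_inv T C i d.+1 R M ->
  reaches W (cost copy_node) copy_node R M (copy_inv T C i d).
Proof.
move=> okT le_C [D1 [[|g D2] [defD //= [sD2] okR [stageR baseR readR todoR]]]].
have sD : size D = size D1 + d.+1 by rewrite defD size_cat /= sD2.
have sC := size_dag_copy T C D1.
have okT1 : table_ok n T (dag_copy T C D1) by apply: table_ok_leq okT; lia.
apply/reaches_wp/(wp_copy_node defD okR okT1); try lia.
move=> R' M' okR' readR' todoR' eq_R'.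
exists (rcons D1 g), D2; rewrite cat_rcons size_rcons dag_copy_rcons -baseR.
rewrite (eq_R' rStage) // (eq_R' rBase) // readR' todoR' todoR subn1.
by split.
Qed.

Lemma machine_inv_set T C R M i v :
  i < n -> machine_inv T C R M ->
  3 + 3 * size D + i < size M /\
  machine_inv (set_nth 0 T i v) C R (set_nth 0 M (3 + 3 * size D + i) v).
Proof.
move=> lt_in [oneR nodesR tableR dagR countR writeR sT le_C ->].
have sC := size_contents C sT.
split; first by rewrite size_pad ?sC; lia.
split=> //; first by rewrite size_set_nth sT; apply/maxn_idPr.
rewrite set_nth_pad ?sC; last by lia.
rewrite /contents set_nth_cat size_enc_problem ltnNge leq_addr addKn.
by rewrite set_nth_cat sT lt_in.
Qed.

Lemma reaches_copy_loop T C i R M :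
  table_ok n T C -> size C + 2 * size D <= capacity -> copy_inv T C i (size D) R M ->
  reaches W (size D * (cost copy_node).+2 + 1) (While rTodo copy_node) R M
    (copy_inv T C i 0).
Proof.
move=> okT le_C; apply: reaches_while => d R' M'; last exact: reaches_copy_node.
by case=> D1 [D2 [_ _ _ []]].
Qed.

Lemma wp_open_stage T C i R M :
  i < n -> machine_inv T C R M -> R rStage = i.+1 ->
  wp W open_stage R M (copy_inv (set_nth 0 T i 1) C i (size D)).
Proof.
move=> lt_in okR stageR; have [oneR nodesR tableR _ countR _ _ le_C _] := okR.
have [lt_M okM] := machine_inv_set 1 lt_in okR.
rewrite /open_stage /= stageR oneR tableR countR nodesR subn1 /=.
do 2 (split; [by [] | by lia |]); split; first by [].
do 3 (split; [by [] | by lia |]).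
by exists [::], D; split=> //; case: okM.
Qed.

Lemma wp_record_root T C R M Q :
  R rStage < n -> machine_inv T C R M ->
  (forall R' M', machine_inv (set_nth 0 T (R rStage) (size C)) C R' M' ->
     state_kept R R' ->
     gate_pair_ready R' (GAnd (size C - 2) (size C - 2)) (GNot (size C)) ->
     Q R' M') ->
  wp W record_root R M Q.
Proof.
move=> lt_in okR QR; have [oneR _ tableR _ countR _ _ le_C _] := okR.
have [lt_M okM] := machine_inv_set (size C) lt_in okR.
rewrite /record_root /= tableR countR oneR -subnDA.
have cap_ge3 := capacity_ge3.
split; [by [] | by lia | split; first by []].
do !(split; [by [] | by lia |]).
apply: QR => //; [ | by do !apply: state_kept_set | by split=> //=; lia].
by apply: machine_inv_kept okM; do !apply: state_kept_set.
Qed.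

Lemma wp_close_stage T C i R M :
  i < n -> size C + 2 * size D + 2 <= capacity ->
  copy_inv (set_nth 0 T i 1) C i 0 R M ->
  wp W close_stage R M (fun R' M' =>
    machine_inv (stage D i T C).1 (stage D i T C).2 R' M' /\ R' rStage = i).
Proof.
move=> lt_in le_C [D1 [D2 [defD /size0nil D2nil okR [stageR _ _ _]]]].
rewrite {}D2nil cats0 in defD; rewrite -{}defD in okR.
have := size_dag_copy (set_nth 0 T i 1) C D; rewrite /stage.
move: (dag_copy _ C D) okR => C' okR sC'.
have lt_stage : R rStage < n by rewrite stageR.
apply/wp_seq/(wp_record_root lt_stage okR) => R1 M1.
rewrite stageR set_set_nth eqxx => okR1 keptR1 ready.
apply: (wp_emit_pair okR1 _ ready) => [|R2 M2 okR2 eq_R2]; first by lia.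
by split=> //; rewrite eq_R2 // keptR1.
Qed.

Lemma wp_init_registers M Q :
  M = pad cells (enc_problem D) ->
  (forall R, machine_inv (nseq n 0) [::] R M -> R rStage = n ->
     [:: R rTag; R rFst; R rSnd] = [:: 0; 1; 0] -> Q R M) ->
  wp W init_registers (fun=> 0) M Q.
Proof.
move=> eM QR; have cap_ge3 := capacity_ge3.
have sM : size M = cells by rewrite eM size_pad // size_enc_problem; lia.
have load_n : nth 0 M 0 = n by rewrite eM nth_pad.
have load_size : nth 0 M 2 = size D by rewrite eM nth_pad.
rewrite /init_registers /= load_n load_size sM.
do !(split; [by [] || by lia | by lia |]).
apply: QR => //; split=> //=; try lia; first exact: size_nseq.
by rewrite /contents cats0 pad_cat_nseq // size_enc_problem; lia.
Qed.

Lemma wp_setup :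
  wp W setup (fun=> 0) (pad cells (enc_problem D)) (fun R M =>
    machine_inv (nseq n 0) (initial_dag m) R M /\ R rStage = n).
Proof.
rewrite /setup; apply/wp_seq/(wp_init_registers (erefl _)) => R0 okR0 stageR0 regs0.
apply/wp_seq/(wp_emit okR0 (g := GConst true)) => [//||R1 M1 okR1 eq_R1].
  by rewrite regs0.
have regs1 : [:: R1 rTag; R1 rFst; R1 rSnd] = [:: 0; 1; 0] by rewrite !eq_R1.
apply/wp_seq/(wp_emit okR1 (g := GConst true)) => [//||R2 M2 okR2 eq_R2].
  by rewrite regs1.
apply: wp_assign; [by [] | by rewrite /=; lia |].
have okR3 : machine_inv (nseq n 0) [:: GConst true; GConst true]
   [eta R2 with rFst |-> value R2 M2 (Const 0)] M2 by case: okR2.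
apply: (wp_emit okR3 (g := GConst false)) => [//||R4 M4 okR4 eq_R4].
  by case: regs1 => op1 _ r1; rewrite /= !eq_R2 // op1 r1.
by split=> //; rewrite eq_R4 //= eq_R2 // eq_R1.
Qed.

Variable F : form (fvar n m).
Hypotheses (synF : SynNNF F) (dagF : dag_of F D).

Definition stage_inv i R M : Prop :=
  exists T C, [/\ skolem_table F D i T C, machine_inv T C R M, R rStage = i & i <= n].

Lemma reaches_stage_cmd i R M :
  stage_inv i.+1 R M -> reaches W (stage_cost (size D)) stage_cmd R M (stage_inv i).
Proof.
move=> [T [C [tableTC okR stageR lt_in]]]; have [[okT _ sC] _] := tableTC.
have room : size C + 2 * size D + 2 <= capacity.
  have le_stages : (n - i.+1).+1 <= n by lia.
  have := leq_mul le_stages (leqnn (2 * size D + 2)).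
  by rewrite sC /capacity mulSn; lia.
have okT1 : table_ok n (set_nth 0 T i 1) C by apply: table_ok_set; rewrite ?sC.
apply: reaches_seq.
apply: reaches_weaken (reaches_wp (wp_open_stage lt_in okR stageR)) => // R1 M1 copyR1.
apply: reaches_seq.
apply: reaches_weaken (reaches_copy_loop okT1 _ copyR1) => //; last by lia.
move=> R2 M2 copyR2.
apply: reaches_weaken (reaches_wp (wp_close_stage lt_in room copyR2)) => //.
move=> R3 M3 [okR3 stageR3].
exists (stage D i T C).1, (stage D i T C).2; split=> //; last exact: ltnW.
exact: (@skolem_tableS _ _ _ _ (Ordinal lt_in)).
Qed.

Lemma reaches_skolem_cmd :
  reaches W (cost setup + (n * (stage_cost (size D)).+2 + 1)) skolem_cmd (fun=> 0)
    (pad cells (enc_problem D)) (stage_inv 0).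
Proof.
apply: reaches_seq; apply: reaches_weaken (reaches_wp wp_setup) => // R M [okR stageR].
apply: reaches_while => [i R' M' [T [C []]] //|i R' M'|].
  exact: reaches_stage_cmd.
exists (nseq n 0), (initial_dag m); split=> //.
by apply: skolem_table_init; case: synF.
Qed.

Lemma machine_inv_outputs p T C R M :
  skolem_table F D 0 T C -> machine_inv T C R M -> outputs_skolem F (Config p R M).
Proof.
move=> tableTC [_ _ tableR dagR countR _ sT _ eM].
have [[[_ ltT] wfC _] _] := tableTC.
exists C, T; split=> //; first split=> //=.
- have := slice_cat (enc_problem D ++ T) (enc_dag (@enc_input_var m) C).
  rewrite size_cat size_enc_problem sT size_enc_dag // => sliceE.
  by rewrite dagR eM /pad /contents -catA -catA catA sliceE.
- have := slice_cat (enc_problem D) T; rewrite size_enc_problem sT => sliceE.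
  by rewrite tableR eM /pad /contents -!catA sliceE.
- by apply: sub_all ltT => t; apply: ltnW.
- exact: skolem_table_is_skolem tableTC.
Qed.

End Correctness.

Lemma cost_skolem_cmd_le n N : 0 < n -> 0 < N ->
  cost setup + (n * (stage_cost N).+2 + 1) <= 200 * (n ^ 2 * N).
Proof.
move=> n_gt0 N_gt0.
have le_nN : n <= n * N by rewrite leq_pmulr.
have le_n2N : n * N <= n ^ 2 * N by rewrite leq_mul2r -mulnn leq_pmulr ?orbT.
have stage_costE : stage_cost N = 6 + (N * 41 + 1 + 26) by [].
have -> : cost setup = 33 by [].
by rewrite stage_costE; lia.
Qed.

Lemma layout_size_le n N : 0 < n -> 0 < N ->
  3 + 3 * N + n + 3 * (3 + n * (2 * N + 2)) <= 200 * (n * N).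
Proof.
move=> n_gt0 N_gt0.
have le_nN : n <= n * N by rewrite leq_pmulr.
have le_Nn : N <= n * N by rewrite leq_pmull.
by rewrite mulnDr mulnCA; lia.
Qed.

Lemma address_lt_word n m N : 0 < n -> 0 < N -> 200 * (n * N) + m < (n + m + N) ^ 200.
Proof.
move=> n_gt0 N_gt0.
have [w_ge2 n_le N_le m_le] :
    [/\ 2 <= n + m + N, n <= n + m + N, N <= n + m + N & m <= n + m + N].
  by split; lia.
move: (n + m + N) w_ge2 n_le N_le m_le => w w_ge2 n_le N_le m_le.
have nN_le : n * N <= w * w by rewrite leq_mul.
have w_le : w <= w * w by rewrite leq_pmulr //; lia.
have w_gt : 256 * (w * w) <= w ^ 200.
  apply: (@leq_trans (w ^ (8 + 2))); last by rewrite leq_pexp2l //; lia.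
  by rewrite expnD mulnn leq_mul2r -[256]/(2 ^ 8) leq_exp2r // w_ge2 orbT.
by apply: leq_trans w_gt => {w_ge2}; lia.
Qed.

Definition skolem_prog : seq instr := compile 0 skolem_cmd ++ [:: IHalt].

Lemma computes_skolem n m (F : form (fvar n m)) (D : seq (gate (fvar n m))) :
  0 < n -> SynNNF F -> dag_of F D ->
  computes skolem_prog ((n + m + size D) ^ 200) (200 * (n ^ 2 * size D))
    (200 * (n * size D)) (enc_problem D) (outputs_skolem F).
Proof.
move=> n_gt0 synF dagF; have [wfD rootF] := dagF.
have D_gt0 : 0 < size D by case: (D) rootF.
have fit_cells := layout_size_le n_gt0 D_gt0; have := address_lt_word m n_gt0 D_gt0.
move: (_ ^ 200) => W fit_word.
apply: computes_compile.
- by rewrite size_enc_problem; lia.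
- by apply: enc_problem_bound => //; lia.
apply: reaches_weaken (reaches_skolem_cmd fit_cells fit_word wfD synF dagF).
  exact: cost_skolem_cmd_le.
by move=> R M [T [C [tableTC okR _ _]]] p; apply: machine_inv_outputs tableTC okR.
Qed.

Theorem theorem1 :
  (forall (n m : nat) (F : form (fvar n m)), SynNNF F ->
     forall i : nat, 1 <= i <= n ->
     forall (x : 'I_n -> bool) (y : 'I_m -> bool),
       ex_prefix F i x y <->
       eval (asg x y) (subst (@bar_neg n m) (reduct F i.+1)))
  /\
  (exists (P : seq instr) (c : nat),
     forall (n m : nat) (F : form (fvar n m)) (D : seq (gate (fvar n m))),
       0 < n -> SynNNF F -> dag_of F D ->
       computes P ((n + m + size D) ^ c)
         (c * (n ^ 2 * size D)) (c * (n * size D))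
         (enc_problem D) (outputs_skolem F)).
Proof.
split=> [n m F synF i /andP[_ le_in] x y|]; first exact: ex_prefixE.
by exists skolem_prog, 200 => n m F D; apply: computes_skolem.
Qed.
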